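(* Let $\sigma\in\mathbb{R}$ and let $L(s)=\sum_{n=0}^\infty a_n e^{-\lambda_n s}$ be a Dirichlet series that is absolutely convergent on $\operatorname{Re}(s)=\sigma$, with $a_0=1$. Then for every $\delta>0$ $$\inf_{T\in\mathbb{R}}\ \max_{t\in[T,T+\delta]}|L(\sigma+it)|\ \ge\ \exp\left(-\pi\left(\frac{(\log\|L\|_1+\log2)^2}{\lambda_1\delta}+\delta\lambda_1\right)\right).$$
   Context: ''$L$ is absolutely convergent on $\operatorname{Re}(s)=\sigma$'' means: $L(s)=\sum_{n=0}^\infty a_n e^{-\lambda_n s}$ with complex coefficients $a_n$ and real exponents satisfying $0=\lambda_0<\lambda_1<\lambda_2<\cdots$, and $\|L\|_1:=\sum_{n=0}^\infty|a_n|e^{-\lambda_n\sigma}<\infty$. *)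

(* Defs.v *)
From Stdlib Require Import Reals.
From Coquelicot Require Import Coquelicot.
Open Scope R_scope.

Definition Cexp (z : C) : C :=
  (exp (Re z) * cos (Im z), exp (Re z) * sin (Im z)).

(* No divergence [lam n -> oo] is required. *)
Definition dirichlet_exponents (lam : nat -> R) : Prop :=
  lam 0%nat = 0 /\ forall n : nat, lam n < lam (S n).

Definition dirichlet_term (a : nat -> C) (lam : nat -> R) (s : C) (n : nat) : C :=
  Cmult (a n) (Cexp (Copp (Cmult (RtoC (lam n)) s))).

Definition is_dirichlet_sum (a : nat -> C) (lam : nat -> R) (s l : C) : Prop :=
  @is_series C_AbsRing C_NormedModule (dirichlet_term a lam s) l.

Definition abs_convergent_on (a : nat -> C) (lam : nat -> R) (sigma : R) : Prop :=
  ex_series (fun n => Cmod (a n) * exp (- (lam n * sigma))).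

(* Meaningful under [abs_convergent_on]: [Series] is total. *)
Definition dirichlet_norm1 (a : nat -> C) (lam : nat -> R) (sigma : R) : R :=
  Series (fun n => Cmod (a n) * exp (- (lam n * sigma))).

Definition is_maximum (E : R -> Prop) (m : R) : Prop :=
  E m /\ is_upper_bound E m.

Definition modulus_values (L : C -> C) (sigma T delta : R) : R -> Prop :=
  fun y => exists t : R, T <= t <= T + delta /\ y = Cmod (L (sigma, t)).

(* Main.v *)
Require Import Defs.
From Stdlib Require Import Reals Lra Lia Psatz.
From Coquelicot Require Import Coquelicot.
Open Scope R_scope.

(** Why the bound holds.  Translating by [s0 = sigma + i (T + delta/2)] replaces
    the coefficients by [b n = a n * exp (- lam n * s0)], with [b 0 = 1] and
    [M := sum |b n|] the norm of the series, and puts the window at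
    [|Im z| <= d], [d = delta/2], on the imaginary axis.  The translated series
    [f] satisfies [|f| <= M] on the half-plane [Re z >= 0], and [|f| <= m] on
    the window, where [m] is the maximum in question.

    Two facts collide.  Deep in the half-plane [f] is close to its constant
    term: [|f x - 1| <= (M - 1) exp (- lam 1 * x)], so [|f x| >= 1/2] at
    [x = A / lam 1] with [A = ln M + ln 2].  On the other hand
    [ln |f|] is subharmonic, so it lies below the harmonic function with boundary
    values [ln m] on the window and [ln M] elsewhere.  The window has harmonic
    measure [(2/PI) atan (d/x)] seen from [x], whence
    [ln (1/2) <= ln M - (ln M - ln m) (2/PI) atan (d/x)].  Solving for [ln m]
    and using [atan r >= r / (1 + r^2)] at [r = d/x] gives
    [- ln m <= PI (A^2 / (lam 1 * delta) + delta * lam 1 / 4)], which is better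
    than required.

    The subharmonic comparison ([two_constants]) is proved for functions with two
    complex derivatives, given through their partial derivatives.  Where a
    product [|f|^2 exp phi] has a local maximum and [f] does not vanish, its
    gradient vanishes; then [|f|^2 Lap |f|^2 = |grad |f|^2|^2] turns the second
    derivative test into [Lap phi <= 0].  So if [Lap phi > 0] there is no interior
    maximum ([max_principle]).  Taking [phi] to be a multiple of the harmonic
    measure makes the boundary values of [|f|^2 exp phi] at most [M^2], up to
    perturbations of size [k] that regularise the two endpoints of the window,
    force decay at infinity and make [Lap phi] strictly positive; then [k] tends
    to 0.

    The comparison is applied to partial sums, which are entire, and reaches
    [f] because the partial sums converge uniformly on the line
    ([uniform_truncation]). *)

(** * Second derivative test with an exponential weight *)

(** If [l] were positive, [g1] would be positive just to the right of its zero [x],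
    and [g] would exceed [g x] there by the mean value theorem. *)
Lemma local_max_derivative_test (g g1 : R -> R) (x l : R) :
  locally x (fun t => is_derive g t (g1 t)) ->
  is_derive g1 x l ->
  locally x (fun t => g t <= g x) ->
  g1 x = 0 /\ l <= 0.
Proof.
  intros [d1 Hd] Hl [d2 Hm].
  assert (Hx : derivable_pt_lim g x (g1 x))
    by (apply is_derive_Reals, Hd, ball_center).
  set (r := Rmin d1 d2).
  assert (Hr : 0 < r)
    by (unfold r; apply Rmin_pos; [apply cond_pos | apply cond_pos]).
  assert (Hr1 : r <= d1) by apply Rmin_l.
  assert (Hr2 : r <= d2) by apply Rmin_r.
  assert (H1 : g1 x = 0).
  { pose (pr := exist _ (g1 x) Hx : derivable_pt g x).
    change (derive_pt g x pr = 0).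
    apply (deriv_maximum g (x - r) (x + r)); try lra.
    intros y Hy1 Hy2. apply Hm. apply Rabs_def1; simpl;
      unfold minus, plus, opp; simpl; lra. }
  split; [exact H1 |].
  destruct (Rle_or_lt l 0) as [H | H]; [exact H | exfalso].
  apply is_derive_Reals in Hl.
  destruct (Hl (l / 2) ltac:(lra)) as [d3 Hd3].
  set (h := Rmin d3 r / 2).
  assert (Hh : 0 < h < d3 /\ h < r).
  { pose proof (cond_pos d3). unfold h.
    pose proof (Rmin_l d3 r). pose proof (Rmin_r d3 r).
    assert (0 < Rmin d3 r) by (apply Rmin_pos; assumption). lra. }
  destruct (MVT_cor2 g g1 x (x + h)) as [c [Hc1 Hc2]]; [lra | | ].
  { intros c Hc. apply is_derive_Reals, Hd. apply Rabs_def1; simpl;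
      unfold minus, plus, opp; simpl; lra. }
  assert (Hg : g (x + h) <= g x).
  { apply Hm. apply Rabs_def1; simpl; unfold minus, plus, opp; simpl; lra. }
  assert (Hpos : 0 < g1 c).
  { specialize (Hd3 (c - x) ltac:(lra)).
    replace (x + (c - x)) with c in Hd3 by ring.
    rewrite H1, Rminus_0_r in Hd3.
    assert (Habs : Rabs (c - x) < d3) by (apply Rabs_def1; lra).
    specialize (Hd3 Habs). apply Rabs_def2 in Hd3.
    assert (Hq : 0 < g1 c / (c - x)) by lra.
    replace (g1 c) with (g1 c / (c - x) * (c - x)) by (field; lra).
    apply Rmult_lt_0_compat; lra. }
  nra.
Qed.

Lemma is_derive_Rplus (p q : R -> R) (x p1 q1 : R) :
  is_derive p x p1 -> is_derive q x q1 ->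
  is_derive (fun t => p t + q t) x (p1 + q1).
Proof. exact (is_derive_plus p q x p1 q1). Qed.

(** The second derivative test for [u exp phi], divided by the positive factor
    [exp phi] and with [u1 x] eliminated by means of the first order condition. *)
Lemma weighted_local_max (u u1 phi phi1 : R -> R) (u2 phi2 x : R) :
  (forall t, is_derive u t (u1 t)) -> is_derive u1 x u2 ->
  locally x (fun t => is_derive phi t (phi1 t)) -> is_derive phi1 x phi2 ->
  locally x (fun t => u t * exp (phi t) <= u x * exp (phi x)) ->
  u1 x = - (u x * phi1 x) /\ u2 - u x * phi1 x ^ 2 + u x * phi2 <= 0.
Proof.
  intros Hu Hu1 Hp Hp1 Hm.
  assert (He : forall t, is_derive phi t (phi1 t) ->
            is_derive (fun s => exp (phi s)) t (phi1 t * exp (phi t))).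
  { intros t Ht.
    apply (is_derive_comp exp phi t); [apply is_derive_exp | exact Ht]. }
  assert (Hpx := locally_singleton _ _ Hp).
  destruct (local_max_derivative_test
    (fun t => u t * exp (phi t))
    (fun t => (u1 t + u t * phi1 t) * exp (phi t)) x
    ((u2 + (u1 x * phi1 x + u x * phi2)) * exp (phi x)
       + (u1 x + u x * phi1 x) * (phi1 x * exp (phi x)))) as [H1 H2].
  - revert Hp. apply filter_imp. intros t Ht.
    evar_last.
    + apply Derive.is_derive_mult; [apply Hu | apply He, Ht].
    + simpl. ring.
  - apply (Derive.is_derive_mult (fun t => u1 t + u t * phi1 t) (fun t => exp (phi t)));
      [| apply He, Hpx].
    apply is_derive_Rplus; [exact Hu1 |].
    apply Derive.is_derive_mult; [apply Hu | apply Hp1].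
  - exact Hm.
  - pose proof (exp_pos (phi x)) as Hex.
    assert (E1 : u1 x = - (u x * phi1 x)).
    { apply Rmult_integral in H1. lra. }
    split; [exact E1 |].
    rewrite E1 in H2.
    apply (Rmult_le_reg_r (exp (phi x))); [exact Hex |]. lra.
Qed.

(** * Laplacians of the building blocks *)

(** Phrased through the pure second derivatives along the axes, because the second
    derivative test is applied in each variable separately. *)
Definition laplacian_at (phi : R -> R -> R) (x y l : R) : Prop :=
  exists (gx gy : R -> R) (lx ly : R),
    locally x (fun t => is_derive (fun s => phi s y) t (gx t)) /\
    is_derive gx x lx /\
    locally y (fun t => is_derive (fun s => phi x s) t (gy t)) /\
    is_derive gy y ly /\
    l = lx + ly.

Lemma laplacian_plus (f g : R -> R -> R) (x y l m : R) :
  laplacian_at f x y l -> laplacian_at g x y m ->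
  laplacian_at (fun s t => f s t + g s t) x y (l + m).
Proof.
  intros (fx & fy & lx & ly & F1 & F2 & F3 & F4 & ->)
         (gx & gy & mx & my & G1 & G2 & G3 & G4 & ->).
  exists (fun t => fx t + gx t), (fun t => fy t + gy t), (lx + mx), (ly + my).
  refine (conj _ (conj _ (conj _ (conj _ _)))).
  - generalize (filter_and _ _ F1 G1). apply filter_imp.
    intros t [? ?]. now apply is_derive_Rplus.
  - now apply is_derive_Rplus.
  - generalize (filter_and _ _ F3 G3). apply filter_imp.
    intros t [? ?]. now apply is_derive_Rplus.
  - now apply is_derive_Rplus.
  - ring.
Qed.

Lemma laplacian_scal (f : R -> R -> R) (k x y l : R) :
  laplacian_at f x y l -> laplacian_at (fun s t => k * f s t) x y (k * l).
Proof.
  intros (fx & fy & lx & ly & F1 & F2 & F3 & F4 & ->).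
  exists (fun t => k * fx t), (fun t => k * fy t), (k * lx), (k * ly).
  refine (conj _ (conj _ (conj _ (conj _ _)))).
  - revert F1. apply filter_imp. intros t ?. now apply is_derive_scal.
  - now apply is_derive_scal.
  - revert F3. apply filter_imp. intros t ?. now apply is_derive_scal.
  - now apply is_derive_scal.
  - ring.
Qed.

Lemma locally_gt (a x : R) : a < x -> locally x (fun t => a < t).
Proof. intros H. now apply (open_gt a). Qed.

(* Closes the side conditions left by differentiation and [field], given the
   positivity [P] of the squared distance they involve. *)
Ltac positive_side P :=
  repeat split; try exact I; try exact P; try (apply Rgt_not_eq; nra);
  try nra.

(** The function is the argument of [(s + k) + i (t - c)], an imaginary part of
    a logarithm. *)
Lemma laplacian_angle (c k x y : R) :
  0 < x + k -> laplacian_at (fun s t => atan ((t - c) / (s + k))) x y 0.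
Proof.
  intros Hx.
  exists (fun s => - (y - c) / ((s + k) ^ 2 + (y - c) ^ 2)),
         (fun t => (x + k) / ((x + k) ^ 2 + (t - c) ^ 2)),
         (2 * (y - c) * (x + k) / ((x + k) ^ 2 + (y - c) ^ 2) ^ 2),
         (- (2 * (y - c) * (x + k)) / ((x + k) ^ 2 + (y - c) ^ 2) ^ 2).
  assert (P : forall s, 0 < s + k -> forall t,
            0 < (s + k) ^ 2 + (t - c) ^ 2)
    by (intros s Hs t; apply Rplus_lt_le_0_compat;
        [apply pow_lt; lra | apply pow2_ge_0]).
  refine (conj _ (conj _ (conj _ (conj _ _)))).
  - apply (filter_imp (fun s => - k < s)); [| apply locally_gt; lra].
    intros s Hs. assert (P' := P s ltac:(lra) y).
    auto_derive; [positive_side P' |]. field. positive_side P'.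
  - assert (P' := P x ltac:(lra) y).
    auto_derive; [positive_side P' |]. field. positive_side P'.
  - apply filter_forall. intros t. assert (P' := P x ltac:(lra) t).
    auto_derive; [positive_side P' |]. field. positive_side P'.
  - assert (P' := P x ltac:(lra) y).
    auto_derive; [positive_side P' |]. field. positive_side P'.
  - assert (P' := P x ltac:(lra) y). field. positive_side P'.
Qed.

(** With [r = |z + 1|] this is [r^-2 - 2 ln r].  The logarithm is harmonic and
    drives the barrier to minus infinity far out; [r^-2] is bounded and has
    the positive Laplacian [4 r^-4], which supplies strictness. *)
Definition barrier (x y : R) : R :=
  / ((x + 1) ^ 2 + y ^ 2) - ln ((x + 1) ^ 2 + y ^ 2).

Lemma laplacian_barrier (x y : R) :
  0 < x -> laplacian_at barrier x y (4 / ((x + 1) ^ 2 + y ^ 2) ^ 2).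
Proof.
  intros Hx.
  exists (fun s => - (2 * (s + 1)) / ((s + 1) ^ 2 + y ^ 2) ^ 2
                   - 2 * (s + 1) / ((s + 1) ^ 2 + y ^ 2)),
         (fun t => - (2 * t) / ((x + 1) ^ 2 + t ^ 2) ^ 2
                   - 2 * t / ((x + 1) ^ 2 + t ^ 2)),
    ((6 * (x + 1) ^ 2 - 2 * y ^ 2) / ((x + 1) ^ 2 + y ^ 2) ^ 3
       - 2 * (y ^ 2 - (x + 1) ^ 2) / ((x + 1) ^ 2 + y ^ 2) ^ 2),
    ((6 * y ^ 2 - 2 * (x + 1) ^ 2) / ((x + 1) ^ 2 + y ^ 2) ^ 3
       - 2 * ((x + 1) ^ 2 - y ^ 2) / ((x + 1) ^ 2 + y ^ 2) ^ 2).
  unfold barrier.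
  assert (P : forall s, 0 < s -> forall t, 0 < (s + 1) ^ 2 + t ^ 2)
    by (intros s Hs t; apply Rplus_lt_le_0_compat;
        [apply pow_lt; lra | apply pow2_ge_0]).
  refine (conj _ (conj _ (conj _ (conj _ _)))).
  - apply (filter_imp (fun s => 0 < s)); [| apply locally_gt; lra].
    intros s Hs. assert (P' := P s ltac:(lra) y).
    auto_derive; [positive_side P' |]. field. positive_side P'.
  - assert (P' := P x ltac:(lra) y).
    auto_derive; [positive_side P' |]. field. positive_side P'.
  - apply filter_forall. intros t. assert (P' := P x ltac:(lra) t).
    auto_derive; [positive_side P' |]. field. positive_side P'.
  - assert (P' := P x ltac:(lra) y).
    auto_derive; [positive_side P' |]. field. positive_side P'.
  - assert (P' := P x ltac:(lra) y). field. positive_side P'.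
Qed.

(** * Maxima on rectangles *)

(** Clamping extends a function continuous on a rectangle to a function uniformly
    continuous on the plane, so that the two-sided one-variable extreme value
    theorem can be used up to the edges. *)
Definition clamp (a b x : R) : R := Rmax a (Rmin b x).

Lemma clamp_in (a b x : R) : a <= b -> a <= clamp a b x <= b.
Proof.
  intros H. unfold clamp. split; [apply Rmax_l |].
  apply Rmax_lub; [exact H | apply Rmin_l].
Qed.

Lemma clamp_id (a b x : R) : a <= x <= b -> clamp a b x = x.
Proof.
  intros [H1 H2]. unfold clamp. rewrite (Rmin_right b x H2). now apply Rmax_right.
Qed.

Lemma clamp_dist (a b x y : R) : a <= b ->
  Rabs (clamp a b x - clamp a b y) <= Rabs (x - y).
Proof.
  intros H. unfold clamp, Rmax, Rmin.
  repeat destruct Rle_dec; unfold Rabs; repeat destruct Rcase_abs; lra.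
Qed.

(** Maximise in [y] first: by uniform continuity the partial maximum is a
    continuous function of [x], which is then maximised in turn. *)
Lemma rectangle_max (V : R -> R -> R) (a b c d : R) :
  a <= b -> c <= d ->
  (forall x y, a <= x <= b -> c <= y <= d -> continuity_2d_pt V x y) ->
  exists x0 y0, a <= x0 <= b /\ c <= y0 <= d /\
    forall x y, a <= x <= b -> c <= y <= d -> V x y <= V x0 y0.
Proof.
  intros Hab Hcd HV.
  set (W := fun x y => V (clamp a b x) (clamp c d y)).
  assert (HW : forall eps, 0 < eps -> exists r, 0 < r /\ forall x y u v,
             Rabs (u - x) < r -> Rabs (v - y) < r ->
             Rabs (W u v - W x y) < eps).
  { intros eps He.
    destruct (uniform_continuity_2d V a b c d HV (mkposreal eps He)) as [r Hr].
    exists r. split; [apply cond_pos |]. intros x y u v Hx Hy.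
    apply Hr; try (apply clamp_in; assumption).
    - eapply Rle_lt_trans; [apply clamp_dist |]; assumption.
    - eapply Rle_lt_trans; [apply clamp_dist |]; assumption. }
  set (g := fun x => real (Lub_Rbar (fun r => exists y, c <= y <= d /\ r = W x y))).
  assert (Hg : forall x, exists y, c <= y <= d /\ g x = W x y /\
                 forall y', c <= y' <= d -> W x y' <= g x).
  { intros x.
    destruct (continuity_ab_maj (W x) c d Hcd) as [y [Hy1 Hy2]].
    { intros y _ eps He. destruct (HW eps He) as [r [Hr Hr']].
      exists r. split; [exact Hr |]. intros v [_ Hv].
      apply Hr'; [| exact Hv]. now rewrite Rminus_diag, Rabs_R0. }
    assert (E : g x = W x y).
    { unfold g. rewrite (is_lub_Rbar_unique _ (Finite (W x y))); [reflexivity |].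
      split.
      - intros r [y' [Hy' ->]]. now apply Hy1.
      - intros B HB. apply HB. now exists y. }
    exists y. rewrite E. auto. }
  destruct (continuity_ab_maj g a b Hab) as [x0 [Hx0 Hx0']].
  { intros x _ eps He. destruct (HW eps He) as [r [Hr Hr']].
    exists r. split; [exact Hr |]. intros u [_ Hu].
    destruct (Hg x) as (y1 & I1 & E1 & M1), (Hg u) as (y2 & I2 & E2 & M2).
    specialize (M1 y2 I2). specialize (M2 y1 I1).
    assert (Z : forall y, Rabs (y - y) < r)
      by (intros; rewrite Rminus_diag, Rabs_R0; exact Hr).
    pose proof (Rabs_def2 _ _ (Hr' x y1 u y1 Hu (Z y1))).
    pose proof (Rabs_def2 _ _ (Hr' x y2 u y2 Hu (Z y2))).
    simpl. unfold Rdist. apply Rabs_def1; lra. }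
  destruct (Hg x0) as (y0 & I0 & E0 & M0).
  exists x0, y0. repeat split; try apply Hx0'; try apply I0.
  intros x y Hx Hy.
  destruct (Hg x) as (y1 & I1 & E1 & M1).
  specialize (M1 y Hy). specialize (Hx0 x Hx).
  rewrite E0 in Hx0. unfold W in *. rewrite !clamp_id in * by assumption. lra.
Qed.

(** * The maximum principle *)

(** The derivative of [f] along the real axis is [f1] and along the imaginary
    axis [i f1]: this encodes the Cauchy-Riemann equations. *)
Definition has_complex_derivative (f f1 : C -> C) : Prop :=
  forall x y : R,
    is_derive (fun t => Re (f (t, y))) x (Re (f1 (x, y))) /\
    is_derive (fun t => Im (f (t, y))) x (Im (f1 (x, y))) /\
    is_derive (fun t => Re (f (x, t))) y (- Im (f1 (x, y))) /\
    is_derive (fun t => Im (f (x, t))) y (Re (f1 (x, y))).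

Lemma is_derive_dot (p q r s p1 q1 r1 s1 : R -> R) (x : R) :
  is_derive p x (p1 x) -> is_derive q x (q1 x) ->
  is_derive r x (r1 x) -> is_derive s x (s1 x) ->
  is_derive (fun t => p t * q t + r t * s t) x
    (p1 x * q x + p x * q1 x + (r1 x * s x + r x * s1 x)).
Proof.
  intros. apply is_derive_Rplus.
  - now apply Derive.is_derive_mult.
  - now apply Derive.is_derive_mult.
Qed.

(** At an interior maximum where [f] does not vanish, write [u = |f|^2], and let
    [k], [m] be the partial derivatives of [phi].  Criticality gives
    [grad u = - u grad phi], the second derivative tests in the two variables add
    up to [Lap u - u |grad phi|^2 + u Lap phi <= 0], and the Cauchy-Riemann
    equations give [Lap u = 4 |f1|^2] and [|grad u|^2 = 4 u |f1|^2].
    Multiplying by [u], the first two terms cancel, leaving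
    [u^2 Lap phi <= 0]. *)
Lemma max_principle (f f1 f2 : C -> C) (phi : R -> R -> R) (a b c d B : R) :
  a <= b -> c <= d ->
  has_complex_derivative f f1 -> has_complex_derivative f1 f2 ->
  (forall x y, a < x < b -> c < y < d ->
     exists l, 0 < l /\ laplacian_at phi x y l) ->
  (forall x y, a <= x <= b -> c <= y <= d ->
     continuity_2d_pt (fun s t => Cmod (f (s, t)) ^ 2 * exp (phi s t)) x y) ->
  (forall x y, a <= x <= b -> c <= y <= d -> x = a \/ x = b \/ y = c \/ y = d ->
     Cmod (f (x, y)) ^ 2 * exp (phi x y) <= B) ->
  forall x y, a <= x <= b -> c <= y <= d ->
    Cmod (f (x, y)) ^ 2 * exp (phi x y) <= B.
Proof.
  intros Hab Hcd Hf Hf1 Hphi Hcont Hbd.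
  destruct (rectangle_max _ a b c d Hab Hcd Hcont)
    as (x0 & y0 & Hx0 & Hy0 & Hmax).
  intros x y Hx Hy. eapply Rle_trans; [now apply Hmax |].
  destruct (Req_dec x0 a) as [Ea | Na]; [now apply Hbd; auto |].
  destruct (Req_dec x0 b) as [Eb | Nb]; [now apply Hbd; auto |].
  destruct (Req_dec y0 c) as [Ec | Nc]; [now apply Hbd; auto |].
  destruct (Req_dec y0 d) as [Ed | Nd]; [now apply Hbd; auto |].
  destruct (Rle_lt_dec (Cmod (f (x0, y0)) ^ 2) 0) as [Z | Hu].
  { apply Rle_trans with (Cmod (f (a, c)) ^ 2 * exp (phi a c)).
    - pose proof (exp_pos (phi x0 y0)). pose proof (exp_pos (phi a c)).
      pose proof (pow2_ge_0 (Cmod (f (a, c)))). nra.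
    - apply Hbd; auto; lra. }
  exfalso.
  destruct (Hphi x0 y0 ltac:(lra) ltac:(lra))
    as (l & Hl & gx & gy & lx & ly & G1 & G2 & G3 & G4 & El).
  set (u := fun s t => Re (f (s, t)) * Re (f (s, t)) + Im (f (s, t)) * Im (f (s, t))).
  assert (Eu : forall s t, Cmod (f (s, t)) ^ 2 = u s t)
    by (intros; rewrite Cmod2_alt; unfold u; ring).
  rewrite Eu in Hu.
  assert (Hmax' : forall s t, a <= s <= b -> c <= t <= d ->
            u s t * exp (phi s t) <= u x0 y0 * exp (phi x0 y0))
    by (intros s t Hs Ht; rewrite <- !Eu; now apply Hmax).
  destruct (weighted_local_max (fun s => u s y0)
    (fun s => 2 * (Re (f (s, y0)) * Re (f1 (s, y0)) + Im (f (s, y0)) * Im (f1 (s, y0))))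
    (fun s => phi s y0) gx
    (2 * (Re (f1 (x0, y0)) * Re (f1 (x0, y0)) + Re (f (x0, y0)) * Re (f2 (x0, y0))
     + (Im (f1 (x0, y0)) * Im (f1 (x0, y0)) + Im (f (x0, y0)) * Im (f2 (x0, y0)))))
    lx x0) as [X1 X2]; try assumption.
  { intros s. evar_last.
    - apply (is_derive_dot (fun s => Re (f (s, y0))) (fun s => Re (f (s, y0)))
        (fun s => Im (f (s, y0))) (fun s => Im (f (s, y0)))
        (fun s => Re (f1 (s, y0))) (fun s => Re (f1 (s, y0)))
        (fun s => Im (f1 (s, y0))) (fun s => Im (f1 (s, y0)))); apply Hf.
    - simpl. ring. }
  { apply (is_derive_scal (fun s => Re (f (s, y0)) * Re (f1 (s, y0))
       + Im (f (s, y0)) * Im (f1 (s, y0)))).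
    apply (is_derive_dot (fun s => Re (f (s, y0))) (fun s => Re (f1 (s, y0)))
        (fun s => Im (f (s, y0))) (fun s => Im (f1 (s, y0)))
        (fun s => Re (f1 (s, y0))) (fun s => Re (f2 (s, y0)))
        (fun s => Im (f1 (s, y0))) (fun s => Im (f2 (s, y0))));
    first [apply Hf | apply Hf1]. }
  { apply (filter_imp (fun s => a < s < b)).
    - intros s Hs. apply Hmax'; lra.
    - apply (locally_interval _ x0 a b); simpl; try lra; intros; lra. }
  destruct (weighted_local_max (fun t => u x0 t)
    (fun t => 2 * (Re (f (x0, t)) * - Im (f1 (x0, t)) + Im (f (x0, t)) * Re (f1 (x0, t))))
    (fun t => phi x0 t) gy
    (2 * (- Im (f1 (x0, y0)) * - Im (f1 (x0, y0)) + Re (f (x0, y0)) * - Re (f2 (x0, y0))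
     + (Re (f1 (x0, y0)) * Re (f1 (x0, y0)) + Im (f (x0, y0)) * - Im (f2 (x0, y0)))))
    ly y0) as [Y1 Y2]; try assumption.
  { intros t. evar_last.
    - apply (is_derive_dot (fun t => Re (f (x0, t))) (fun t => Re (f (x0, t)))
        (fun t => Im (f (x0, t))) (fun t => Im (f (x0, t)))
        (fun t => - Im (f1 (x0, t))) (fun t => - Im (f1 (x0, t)))
        (fun t => Re (f1 (x0, t))) (fun t => Re (f1 (x0, t)))); apply Hf.
    - simpl. ring. }
  { apply (is_derive_scal (fun t => Re (f (x0, t)) * - Im (f1 (x0, t))
       + Im (f (x0, t)) * Re (f1 (x0, t)))).
    apply (is_derive_dot (fun t => Re (f (x0, t))) (fun t => - Im (f1 (x0, t)))
        (fun t => Im (f (x0, t))) (fun t => Re (f1 (x0, t)))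
        (fun t => - Im (f1 (x0, t))) (fun t => - Re (f2 (x0, t)))
        (fun t => Re (f1 (x0, t))) (fun t => - Im (f2 (x0, t))));
    try apply Hf; try apply Hf1.
    apply (is_derive_opp (fun t => Im (f1 (x0, t)))), Hf1. }
  { apply (filter_imp (fun t => c < t < d)).
    - intros t Ht. apply Hmax'; lra.
    - apply (locally_interval _ y0 c d); simpl; try lra; intros; lra. }
  cbv beta in X1, X2, Y1, Y2.
  set (U := u x0 y0) in *. unfold u in U.
  assert (HU : U = Re (f (x0, y0)) ^ 2 + Im (f (x0, y0)) ^ 2) by (unfold U; ring).
  clearbody U. clear - X1 X2 Y1 Y2 Hu Hl HU El.
  set (p := Re (f (x0, y0))) in *. set (q := Im (f (x0, y0))) in *.
  set (p1 := Re (f1 (x0, y0))) in *. set (q1 := Im (f1 (x0, y0))) in *.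
  set (p2 := Re (f2 (x0, y0))) in *. set (q2 := Im (f2 (x0, y0))) in *.
  set (k := gx x0) in *. set (m := gy y0) in *.
  clearbody p q p1 q1 p2 q2 k m.
  (* [S1] is the sum of the two tests, [S2] the identity
     [|grad u|^2 = u Lap u]. *)
  assert (S1 : 4 * (p1 ^ 2 + q1 ^ 2) - U * (k ^ 2 + m ^ 2) + U * l <= 0)
    by (subst l; lra).
  assert (S2 : (U * k) ^ 2 + (U * m) ^ 2 = 4 * U * (p1 ^ 2 + q1 ^ 2)).
  { replace (U * k) with (- (2 * (p * p1 + q * q1))) by lra.
    replace (U * m) with (- (2 * (p * - q1 + q * p1))) by lra.
    rewrite HU. ring. }
  assert (S3 : 0 < U * (U * l)) by (apply Rmult_lt_0_compat; [|apply Rmult_lt_0_compat]; assumption).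
  nra.
Qed.

(** * Elementary inequalities and limits *)

Lemma ex_derive_continuity_pt (g : R -> R) (x : R) :
  ex_derive g x -> continuity_pt g x.
Proof.
  intros [l Hl]. apply derivable_continuous_pt. exists l.
  now apply is_derive_Reals.
Qed.

Lemma right_limit_le (G : R -> R) (r B : R) :
  0 < r -> continuity_pt G 0 -> (forall k, 0 < k < r -> G k <= B) -> G 0 <= B.
Proof.
  intros Hr HG HB. apply Rnot_lt_le. intros H.
  destruct (HG (G 0 - B) ltac:(lra)) as [e [He HeG]].
  set (k := Rmin e r / 2).
  assert (Hk : 0 < k < e /\ k < r).
  { unfold k. pose proof (Rmin_l e r). pose proof (Rmin_r e r).
    assert (0 < Rmin e r) by (apply Rmin_pos; assumption). lra. }
  specialize (HB k ltac:(lra)).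
  assert (Hd : Rabs (G k - G 0) < G 0 - B).
  { apply HeG. split; [split; [exact I | lra] |].
    simpl. unfold Rdist. rewrite Rminus_0_r, Rabs_pos_eq; lra. }
  apply Rabs_def2 in Hd. lra.
Qed.

Lemma exp_le (x y : R) : x <= y -> exp x <= exp y.
Proof.
  intros [H | ->]; [left; now apply exp_increasing | right; reflexivity].
Qed.

Lemma atan_half_pi (x : R) : - (PI / 2) < atan x < PI / 2.
Proof. pose proof (atan_bound x). lra. Qed.

Lemma atan_le (x y : R) : x <= y -> atan x <= atan y.
Proof.
  intros [H | ->]; [left; now apply atan_increasing | right; reflexivity].
Qed.

Lemma atan_bounds (x : R) : 0 < x -> x / (1 + x ^ 2) <= atan x <= x.
Proof.
  intros Hx.
  destruct (MVT_cor2 atan (fun t => / (1 + t ^ 2)) 0 x Hx) as [c [Hc Hcx]].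
  { intros c _. apply derivable_pt_lim_atan. }
  rewrite atan_0, !Rminus_0_r in Hc. rewrite Hc.
  unfold Rdiv. rewrite (Rmult_comm x).
  split; [apply Rmult_le_compat_r; [lra |]; apply Rinv_le_contravar; nra |].
  rewrite <- (Rmult_1_l x) at 2. apply Rmult_le_compat_r; [lra |].
  rewrite <- Rinv_1. apply Rinv_le_contravar; nra.
Qed.

(** * The comparison function *)

(** The angle subtended at [x + k^2 + i y] by the segment
    [|Im z| <= d - k] of the imaginary axis; divided by [PI] it is the harmonic
    measure of that segment.  The shift [k^2] removes the jumps at the endpoints;
    shortening by [k], which is much larger than [k^2], keeps the angle small
    outside the original segment.  The difference is written as a linear
    combination to match [laplacian_plus] and [laplacian_scal]. *)
Definition smoothed_angle (d k x y : R) : R :=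
  atan ((y - - (d - k)) / (x + k ^ 2)) + - 1 * atan ((y - (d - k)) / (x + k ^ 2)).

Lemma smoothed_angle_le_pi (d k x y : R) : smoothed_angle d k x y <= PI.
Proof.
  unfold smoothed_angle.
  pose proof (atan_half_pi ((y - - (d - k)) / (x + k ^ 2))).
  pose proof (atan_half_pi ((y - (d - k)) / (x + k ^ 2))). lra.
Qed.

Lemma smoothed_angle_even (d k x y : R) :
  smoothed_angle d k x (- y) = smoothed_angle d k x y.
Proof.
  unfold smoothed_angle, Rdiv.
  replace (- y - - (d - k)) with (- (y - (d - k))) by ring.
  replace (- y - (d - k)) with (- (y - - (d - k))) by ring.
  rewrite !Ropp_mult_distr_l_reverse, !atan_opp. ring.
Qed.

(** Above the segment the first arctangent is below [PI/2], while the second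
    has argument at least [k / k^2], so that the difference is at most
    [PI/2 - atan (1/k) = atan k]. *)
Lemma smoothed_angle_outside (d k y : R) :
  0 < k -> d < Rabs y -> smoothed_angle d k 0 y <= k.
Proof.
  intros Hk.
  assert (Hpos : forall z, d < z -> smoothed_angle d k 0 z <= k).
  { intros z Hz. unfold smoothed_angle.
    pose proof (atan_half_pi ((z - - (d - k)) / (0 + k ^ 2))) as H1.
    assert (H2 : atan (/ k) <= atan ((z - (d - k)) / (0 + k ^ 2))).
    { apply atan_le. replace (/ k) with (k / (0 + k ^ 2)) by (field; lra).
      apply Rmult_le_compat_r; [| lra]. apply Rlt_le, Rinv_0_lt_compat. nra. }
    rewrite atan_inv in H2 by assumption.
    pose proof (atan_bounds k Hk). lra. }
  intros Hy. destruct (Rle_or_lt 0 y) as [H | H].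
  - apply Hpos. rewrite Rabs_pos_eq in Hy; assumption.
  - rewrite <- smoothed_angle_even. apply Hpos.
    rewrite Rabs_left in Hy; assumption.
Qed.

Lemma barrier_le_1 (x y : R) : 0 <= x -> barrier x y <= 1.
Proof.
  intros Hx. unfold barrier.
  assert (HR : 1 <= (x + 1) ^ 2 + y ^ 2)
    by (pose proof (pow2_ge_0 y); nra).
  assert (/ ((x + 1) ^ 2 + y ^ 2) <= 1)
    by (rewrite <- Rinv_1; apply Rinv_le_contravar; lra).
  assert (0 <= ln ((x + 1) ^ 2 + y ^ 2)).
  { rewrite <- ln_1. apply ln_le; lra. }
  lra.
Qed.

(** Outside a rectangle of size [X] the squared distance is at least [X^2]. *)
Lemma barrier_far (X x y : R) :
  0 < X -> 0 <= x -> X <= x \/ X <= Rabs y -> barrier x y <= 1 - 2 * ln X.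
Proof.
  intros HX Hx Hfar. unfold barrier.
  pose proof (pow2_ge_0 y) as Hy2.
  assert (HR : 1 <= (x + 1) ^ 2 + y ^ 2) by nra.
  assert (/ ((x + 1) ^ 2 + y ^ 2) <= 1)
    by (rewrite <- Rinv_1; apply Rinv_le_contravar; lra).
  assert (HX2 : X ^ 2 <= (x + 1) ^ 2 + y ^ 2).
  { destruct Hfar as [H' | H']; [nra |].
    rewrite <- (pow2_abs y). nra. }
  assert (2 * ln X <= ln ((x + 1) ^ 2 + y ^ 2)).
  { replace (2 * ln X) with (ln (X ^ 2)) by (simpl; rewrite Rmult_1_r, ln_mult by assumption; ring).
    apply ln_le; [nra | exact HX2]. }
  lra.
Qed.

(** [K] stands for [ln M - ln m]; its factor 2 matches the square in
    [|f|^2 exp phi]. *)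
Definition weight (K d k x y : R) : R :=
  2 * K / PI * smoothed_angle d k x y + k * barrier x y.

Lemma weight_strictly_subharmonic (K d k x y : R) :
  0 < k -> 0 < x -> exists l, 0 < l /\ laplacian_at (weight K d k) x y l.
Proof.
  intros Hk Hx.
  exists (2 * K / PI * (0 + - 1 * 0) + k * (4 / ((x + 1) ^ 2 + y ^ 2) ^ 2)).
  split.
  - rewrite Rmult_0_r, Rplus_0_r, Rmult_0_r, Rplus_0_l.
    apply Rmult_lt_0_compat; [exact Hk |].
    apply Rdiv_lt_0_compat; [lra |]. apply pow_lt.
    pose proof (pow2_ge_0 y). nra.
  - apply laplacian_plus; apply laplacian_scal; [| now apply laplacian_barrier].
    apply laplacian_plus; [| apply laplacian_scal]; apply laplacian_angle; nra.
Qed.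

Lemma weight_continuous (K d k x y : R) :
  0 < k -> 0 <= x -> continuity_2d_pt (weight K d k) x y.
Proof.
  intros Hk Hx. unfold weight, smoothed_angle, barrier.
  assert (HR : 0 < (x + 1) ^ 2 + y ^ 2) by (pose proof (pow2_ge_0 y); nra).
  assert (HN : continuity_2d_pt (fun s t => (s + 1) ^ 2 + t ^ 2) x y).
  { apply continuity_2d_pt_plus.
    - apply (continuity_1d_2d_pt_comp (fun s => (s + 1) ^ 2) (fun s _ => s));
        [apply ex_derive_continuity_pt; auto_derive; exact I
        | apply continuity_2d_pt_id1].
    - apply (continuity_1d_2d_pt_comp (fun s => s ^ 2) (fun _ t => t));
        [apply ex_derive_continuity_pt; auto_derive; exact I
        | apply continuity_2d_pt_id2]. }
  assert (HA : forall e, continuity_2d_pt (fun s t => atan ((t - e) / (s + k ^ 2))) x y).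
  { intros e. apply (continuity_1d_2d_pt_comp atan (fun s t => (t - e) / (s + k ^ 2))).
    - apply ex_derive_continuity_pt; auto_derive; exact I.
    - apply continuity_2d_pt_mult.
      + apply continuity_2d_pt_minus;
          [apply continuity_2d_pt_id2 | apply continuity_2d_pt_const].
      + apply continuity_2d_pt_inv; [| nra].
        apply continuity_2d_pt_plus;
          [apply continuity_2d_pt_id1 | apply continuity_2d_pt_const]. }
  apply continuity_2d_pt_plus; (apply continuity_2d_pt_mult;
    [apply continuity_2d_pt_const |]).
  - apply continuity_2d_pt_plus; [apply HA |].
    apply continuity_2d_pt_mult; [apply continuity_2d_pt_const | apply HA].
  - apply continuity_2d_pt_minus.
    + apply continuity_2d_pt_inv; [exact HN | lra].
    + apply (continuity_1d_2d_pt_comp ln _ x y); [| exact HN].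
      apply ex_derive_continuity_pt; auto_derive; exact HR.
Qed.

(** * The two-constants theorem *)

(** The two-constants theorem for the half-plane.  On the boundary of a large
    rectangle [|f|^2 exp phi], for the weight with parameter [k], is at most
    [M^2 exp ((2 K + 1) k)]:
    on the window because [m^2 exp (2 K) = M^2], on the rest of the imaginary
    axis because the angle is at most [k], and on the far sides because the
    barrier compensates [exp (2 K)].  The maximum principle carries the bound to
    the point [x], and [k] tends to 0. *)
Theorem two_constants (f f1 f2 : C -> C) (M m d : R) :
  has_complex_derivative f f1 -> has_complex_derivative f1 f2 ->
  (forall x y, continuity_2d_pt (fun s t => Cmod (f (s, t)) ^ 2) x y) ->
  (forall x y, 0 <= x -> Cmod (f (x, y)) <= M) ->
  (forall y, Rabs y <= d -> Cmod (f (0, y)) <= m) ->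
  0 < m <= M -> 0 < d ->
  forall x, 0 < x ->
    Cmod (f (x, 0)) * exp ((ln M - ln m) * (2 / PI) * atan (d / x)) <= M.
Proof.
  intros Hf Hf1 Hcont HM Hm HmM Hd x Hx.
  set (K := ln M - ln m).
  pose proof PI_RGT_0 as Hpi.
  assert (HK : 0 <= K).
  { unfold K. pose proof (ln_le m M (proj1 HmM) (proj2 HmM)). lra. }
  assert (HMK : M ^ 2 = m ^ 2 * exp (2 * K)).
  { replace (2 * K) with (K + K) by ring. unfold K. rewrite exp_plus.
    unfold Rminus. rewrite exp_plus, exp_Ropp, !exp_ln by lra. field. lra. }
  (* The boundary excess [(2 K + 1) k] is moved into the exponent, which leaves a
     bound uniform in [k]. *)
  set (G := fun k => Cmod (f (x, 0)) ^ 2 *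
                       exp (weight K d k x 0 - (2 * K + 1) * k)).
  assert (HG : G 0 <= M ^ 2).
  { apply (right_limit_le G 1); [lra | |].
    { apply ex_derive_continuity_pt. unfold G, weight, smoothed_angle.
      auto_derive. split; [nra | split; [nra | exact I]]. }
    intros k Hk. unfold G.
    (* Large enough for [x] to lie in the rectangle and for [2 k ln X] to absorb
       the bound [2 K] of the angle part of the weight on the far sides. *)
    set (X := Rmax x (exp (K / k))).
    assert (HX1 : x <= X) by apply Rmax_l.
    assert (HX2 : exp (K / k) <= X) by apply Rmax_r.
    pose proof (exp_pos (K / k)) as HX0.
    assert (HlnX : K <= k * ln X).
    { replace K with (k * (K / k)) by (field; lra).
      apply Rmult_le_compat_l; [lra |].
      rewrite <- (ln_exp (K / k)) at 1. now apply ln_le. }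
    assert (Hmax : Cmod (f (x, 0)) ^ 2 * exp (weight K d k x 0)
                     <= M ^ 2 * exp ((2 * K + 1) * k)).
    { refine (max_principle f f1 f2 (weight K d k) 0 X (- X) X _ _ _ Hf Hf1
                _ _ _ x 0 _ _); try lra.
      - intros s t Hs _. apply weight_strictly_subharmonic; lra.
      - intros s t Hs _.
        apply continuity_2d_pt_mult; [apply Hcont |].
        apply (continuity_1d_2d_pt_comp exp (weight K d k)).
        + apply ex_derive_continuity_pt; auto_derive; exact I.
        + apply weight_continuous; lra.
      - intros s t Hs Ht Hedge.
        pose proof (Cmod_ge_0 (f (s, t))) as Hf0.
        assert (HfM := HM s t ltac:(lra)).
        assert (HfM2 : Cmod (f (s, t)) ^ 2 <= M ^ 2) by (apply pow_incr; lra).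
        assert (Hang := smoothed_angle_le_pi d k s t).
        assert (Hbar := barrier_le_1 s t ltac:(lra)).
        assert (HKpi : 0 <= 2 * K / PI) by (apply Rle_div_r; lra).
        assert (Hw : 2 * K / PI * smoothed_angle d k s t <= 2 * K).
        { replace (2 * K) with (2 * K / PI * PI) at 2 by (field; lra).
          now apply Rmult_le_compat_l. }
        assert (Hcase : forall B w, Cmod (f (s, t)) ^ 2 <= B ->
                  weight K d k s t <= w ->
                  B * exp w <= M ^ 2 * exp ((2 * K + 1) * k) ->
                  Cmod (f (s, t)) ^ 2 * exp (weight K d k s t)
                    <= M ^ 2 * exp ((2 * K + 1) * k)).
        { intros B w HB Hle. apply Rle_trans.
          apply Rmult_le_compat; [apply pow2_ge_0 | left; apply exp_pos | exact HB |].
          now apply exp_le. }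
        assert (Hexp : forall w, w <= (2 * K + 1) * k ->
                  M ^ 2 * exp w <= M ^ 2 * exp ((2 * K + 1) * k)).
        { intros w Hle.
          apply Rmult_le_compat_l; [apply pow2_ge_0 | now apply exp_le]. }
        assert (HKk : 0 <= K * k) by nra.
        destruct (Rle_or_lt X s) as [HXs | HXs];
          [| destruct (Rle_or_lt X (Rabs t)) as [HXt | HXt]].
        + apply (Hcase (M ^ 2) k HfM2); [| apply Hexp; lra].
          assert (Hfar := barrier_far X s t ltac:(lra) ltac:(lra) (or_introl HXs)).
          unfold weight. nra.
        + apply (Hcase (M ^ 2) k HfM2); [| apply Hexp; lra].
          assert (Hfar := barrier_far X s t ltac:(lra) ltac:(lra) (or_intror HXt)).
          unfold weight. nra.
        + assert (Es : s = 0).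
          { apply Rabs_def2 in HXt. lra. }
          subst s.
          destruct (Rle_or_lt (Rabs t) d) as [Htd | Htd].
          * apply (Hcase (m ^ 2) (2 * K + k)).
            -- apply pow_incr. split; [exact Hf0 | now apply Hm].
            -- unfold weight. nra.
            -- rewrite exp_plus, <- Rmult_assoc, <- HMK. apply Hexp. lra.
          * apply (Hcase (M ^ 2) ((2 * K + 1) * k) HfM2); [| apply Hexp; lra].
            assert (Hout := smoothed_angle_outside d k t ltac:(lra) Htd).
            assert (H1 : 2 * K / PI * smoothed_angle d k 0 t <= 2 * K * k).
            { apply Rle_trans with (2 * K / PI * k);
                [now apply Rmult_le_compat_l |].
              apply Rmult_le_compat_r; [lra |].
              apply Rle_div_l; [lra |]. pose proof PI2_1. nra. }
            unfold weight. nra. }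
    unfold Rminus. rewrite exp_plus, exp_Ropp, <- Rmult_assoc.
    apply (Rle_div_l _ _ (exp ((2 * K + 1) * k))); [apply exp_pos | exact Hmax]. }
  unfold G in HG. rewrite Rmult_0_r, Rminus_0_r in HG.
  assert (EW : weight K d 0 x 0 = 2 * (K * (2 / PI) * atan (d / x))).
  { unfold weight, smoothed_angle.
    replace ((0 - - (d - 0)) / (x + 0 ^ 2)) with (d / x) by (field; lra).
    replace ((0 - (d - 0)) / (x + 0 ^ 2)) with (- (d / x)) by (field; lra).
    rewrite atan_opp. field. lra. }
  rewrite EW in HG.
  set (E := exp (K * (2 / PI) * atan (d / x))) in *.
  assert (EE : exp (2 * (K * (2 / PI) * atan (d / x))) = E ^ 2).
  { unfold E. replace (2 * (K * (2 / PI) * atan (d / x)))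
      with (K * (2 / PI) * atan (d / x) + K * (2 / PI) * atan (d / x)) by ring.
    rewrite exp_plus. ring. }
  rewrite EE, <- Rpow_mult_distr in HG.
  apply Rsqr_incr_0_var; [rewrite !Rsqr_pow2; exact HG | lra].
Qed.

(** * Dirichlet polynomials *)

Lemma Cexp_plus (z w : C) : Cexp (Cplus z w) = Cmult (Cexp z) (Cexp w).
Proof.
  destruct z as [x y], w as [u v]. unfold Cexp, Cmult, Cplus; simpl.
  rewrite exp_plus, cos_plus, sin_plus. apply injective_projections; simpl; ring.
Qed.

Lemma Cmod_Cexp (z : C) : Cmod (Cexp z) = exp (Re z).
Proof.
  unfold Cmod, Cexp; simpl.
  match goal with |- sqrt ?e = _ =>
    replace e with (exp (Re z) * exp (Re z) * (Rsqr (sin (Im z)) + Rsqr (cos (Im z))))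
      by (unfold Rsqr; ring) end.
  rewrite sin2_cos2, Rmult_1_r. apply sqrt_square. left; apply exp_pos.
Qed.

Lemma Cmod_dirichlet_term (a : nat -> C) (lam : nat -> R) (s : C) (n : nat) :
  Cmod (dirichlet_term a lam s n) = Cmod (a n) * exp (- (lam n * Re s)).
Proof.
  unfold dirichlet_term. rewrite Cmod_mult, Cmod_Cexp. do 2 f_equal.
  destruct s as [x y]; simpl. ring.
Qed.

(** The terms at [s] serve as coefficients of the series translated by [s];
    this reduces any point of the line to the origin. *)
Lemma dirichlet_term_translate (a : nat -> C) (lam : nat -> R) (s z : C) (n : nat) :
  dirichlet_term (dirichlet_term a lam s) lam z n
    = dirichlet_term a lam (Cplus s z) n.
Proof.
  unfold dirichlet_term. rewrite <- Cmult_assoc, <- Cexp_plus. do 2 f_equal.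
  ring.
Qed.

Lemma dirichlet_term_pair (a : nat -> C) (lam : nat -> R) (x y : R) (n : nat) :
  dirichlet_term a lam (x, y) n =
  (exp (- (lam n * x)) * (Re (a n) * cos (lam n * y) + Im (a n) * sin (lam n * y)),
   exp (- (lam n * x)) * (Im (a n) * cos (lam n * y) - Re (a n) * sin (lam n * y))).
Proof.
  unfold dirichlet_term, Cexp. destruct (a n) as [p q]. simpl.
  replace (- (lam n * x - 0 * y)) with (- (lam n * x)) by ring.
  replace (- (lam n * y + 0 * x)) with (- (lam n * y)) by ring.
  rewrite cos_neg, sin_neg. unfold Cmult; simpl.
  apply injective_projections; simpl; ring.
Qed.

Definition dirichlet_polynomial (a : nat -> C) (lam : nat -> R) (N : nat) (s : C) : C :=
  sum_n (G := C_NormedModule) (dirichlet_term a lam s) N.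

Lemma dirichlet_polynomial_O (a : nat -> C) (lam : nat -> R) (s : C) :
  dirichlet_polynomial a lam 0 s = dirichlet_term a lam s 0.
Proof. exact (sum_O (G := C_NormedModule) (dirichlet_term a lam s)). Qed.

Lemma dirichlet_polynomial_S (a : nat -> C) (lam : nat -> R) (N : nat) (s : C) :
  dirichlet_polynomial a lam (S N) s =
  Cplus (dirichlet_polynomial a lam N s) (dirichlet_term a lam s (S N)).
Proof. exact (sum_Sn (G := C_NormedModule) (dirichlet_term a lam s) N). Qed.

Lemma has_complex_derivative_plus (f g f1 g1 : C -> C) :
  has_complex_derivative f f1 -> has_complex_derivative g g1 ->
  has_complex_derivative (fun s => Cplus (f s) (g s)) (fun s => Cplus (f1 s) (g1 s)).
Proof.
  intros Hf Hg x y.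
  destruct (Hf x y) as (F1 & F2 & F3 & F4), (Hg x y) as (G1 & G2 & G3 & G4).
  refine (conj _ (conj _ (conj _ _))); simpl.
  - now apply is_derive_Rplus.
  - now apply is_derive_Rplus.
  - rewrite Ropp_plus_distr. now apply is_derive_Rplus.
  - now apply is_derive_Rplus.
Qed.

Lemma has_complex_derivative_ext (f g f1 g1 : C -> C) :
  (forall s, f s = g s) -> (forall s, f1 s = g1 s) ->
  has_complex_derivative f f1 -> has_complex_derivative g g1.
Proof.
  intros E E1 Hf x y. rewrite <- E1.
  destruct (Hf x y) as (F1 & F2 & F3 & F4).
  refine (conj _ (conj _ (conj _ _)));
  (eapply is_derive_ext; [| eassumption]); intros t; simpl; now rewrite E.
Qed.

Definition derivative_coefficients (a : nat -> C) (lam : nat -> R) (n : nat) : C :=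
  Cmult (RtoC (- lam n)) (a n).

Lemma dirichlet_term_derivative (a : nat -> C) (lam : nat -> R) (n : nat) :
  has_complex_derivative (fun s => dirichlet_term a lam s n)
    (fun s => dirichlet_term (derivative_coefficients a lam) lam s n).
Proof.
  intros x y. cbv beta. rewrite dirichlet_term_pair.
  unfold derivative_coefficients.
  refine (conj _ (conj _ (conj _ _)));
  (eapply is_derive_ext; [intros t; cbv beta; rewrite dirichlet_term_pair; reflexivity |]);
  destruct (a n) as [p q]; simpl; auto_derive; trivial; ring.
Qed.

Lemma dirichlet_polynomial_derivative (a : nat -> C) (lam : nat -> R) (N : nat) :
  has_complex_derivative (dirichlet_polynomial a lam N)
    (dirichlet_polynomial (derivative_coefficients a lam) lam N).
Proof.
  induction N as [| N IH].
  - eapply has_complex_derivative_ext; [| | apply (dirichlet_term_derivative a lam 0)];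
    intros s; symmetry; apply dirichlet_polynomial_O.
  - eapply has_complex_derivative_ext;
      [| | apply (has_complex_derivative_plus _ _ _ _ IH (dirichlet_term_derivative a lam (S N)))];
    intros s; symmetry; apply dirichlet_polynomial_S.
Qed.

Lemma dirichlet_term_continuous (a : nat -> C) (lam : nat -> R) (n : nat) (x y : R) :
  continuity_2d_pt (fun s t => Re (dirichlet_term a lam (s, t) n)) x y /\
  continuity_2d_pt (fun s t => Im (dirichlet_term a lam (s, t) n)) x y.
Proof.
  assert (H : forall p q, continuity_2d_pt (fun s t => exp (- (lam n * s)) *
             (p * cos (lam n * t) + q * sin (lam n * t))) x y).
  { intros p q. apply continuity_2d_pt_mult.
    - apply (continuity_1d_2d_pt_comp (fun s => exp (- (lam n * s))) (fun s _ => s));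
        [apply ex_derive_continuity_pt; auto_derive; exact I
        | apply continuity_2d_pt_id1].
    - apply (continuity_1d_2d_pt_comp
               (fun t => p * cos (lam n * t) + q * sin (lam n * t)) (fun _ t => t));
        [apply ex_derive_continuity_pt; auto_derive; repeat split
        | apply continuity_2d_pt_id2]. }
  split.
  - eapply continuity_2d_pt_ext; [| apply (H (Re (a n)) (Im (a n)))].
    intros s t. now rewrite dirichlet_term_pair.
  - eapply continuity_2d_pt_ext; [| apply (H (Im (a n)) (- Re (a n)))].
    intros s t. rewrite dirichlet_term_pair. simpl. ring.
Qed.

Lemma dirichlet_polynomial_continuous (a : nat -> C) (lam : nat -> R) (N : nat) (x y : R) :
  continuity_2d_pt (fun s t => Re (dirichlet_polynomial a lam N (s, t))) x y /\
  continuity_2d_pt (fun s t => Im (dirichlet_polynomial a lam N (s, t))) x y.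
Proof.
  induction N as [| N [IHr IHi]].
  - destruct (dirichlet_term_continuous a lam 0 x y) as [Hr Hi].
    split; [refine (continuity_2d_pt_ext _ _ x y _ Hr)
           | refine (continuity_2d_pt_ext _ _ x y _ Hi)];
    intros s t; now rewrite dirichlet_polynomial_O.
  - destruct (dirichlet_term_continuous a lam (S N) x y) as [Hr Hi].
    split.
    + refine (continuity_2d_pt_ext _ _ x y _ (continuity_2d_pt_plus _ _ _ _ IHr Hr)).
      intros s t; now rewrite dirichlet_polynomial_S.
    + refine (continuity_2d_pt_ext _ _ x y _ (continuity_2d_pt_plus _ _ _ _ IHi Hi)).
      intros s t; now rewrite dirichlet_polynomial_S.
Qed.

Lemma dirichlet_polynomial_Cmod_continuous (a : nat -> C) (lam : nat -> R) (N : nat) (x y : R) :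
  continuity_2d_pt (fun s t => Cmod (dirichlet_polynomial a lam N (s, t)) ^ 2) x y.
Proof.
  destruct (dirichlet_polynomial_continuous a lam N x y) as [Hr Hi].
  refine (continuity_2d_pt_ext _ _ x y _
    (continuity_2d_pt_plus _ _ _ _ (continuity_2d_pt_mult _ _ _ _ Hr Hr)
       (continuity_2d_pt_mult _ _ _ _ Hi Hi))).
  intros s t. rewrite Cmod2_alt. ring.
Qed.

(** * Lower bound for Dirichlet polynomials *)

Lemma exponents_ge (lam : nat -> R) (n : nat) :
  dirichlet_exponents lam -> lam 1%nat <= lam (S n).
Proof.
  intros [_ H]. induction n as [| n IH]; [lra |].
  specialize (H (S n)). lra.
Qed.

Lemma exponents_nonneg (lam : nat -> R) (n : nat) :
  dirichlet_exponents lam -> 0 <= lam n.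
Proof.
  intros H. destruct n as [| n]; [destruct H; lra |].
  pose proof (exponents_ge lam n H) as Hge. destruct H as [Hzero Hincr].
  specialize (Hincr 0%nat). lra.
Qed.

Lemma dirichlet_polynomial_bound (b : nat -> C) (lam : nat -> R) (N : nat) (s : C) :
  dirichlet_exponents lam -> 0 <= Re s ->
  Cmod (dirichlet_polynomial b lam N s) <= sum_n (fun n => Cmod (b n)) N.
Proof.
  intros Hlam Hs.
  assert (Ht : forall n, Cmod (dirichlet_term b lam s n) <= Cmod (b n)).
  { intros n. rewrite Cmod_dirichlet_term.
    pose proof (exponents_nonneg lam n Hlam).
    assert (He : exp (- (lam n * Re s)) <= 1) by (rewrite <- exp_0; apply exp_le; nra).
    pose proof (Cmod_ge_0 (b n)). nra. }
  induction N as [| N IH].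
  - rewrite dirichlet_polynomial_O, sum_O. apply Ht.
  - rewrite dirichlet_polynomial_S, sum_Sn. eapply Rle_trans; [apply Cmod_triangle |].
    apply Rplus_le_compat; [exact IH | apply Ht].
Qed.

(** Every frequency but the zeroth is at least [lam 1], so all non-constant
    terms decay at least like [exp (- lam 1 * x)]. *)
Lemma dirichlet_polynomial_near_1 (b : nat -> C) (lam : nat -> R) (N : nat) (x : R) :
  dirichlet_exponents lam -> b 0%nat = RtoC 1 -> 0 <= x ->
  Cmod (Cminus (dirichlet_polynomial b lam N (x, 0)) (RtoC 1))
    <= (sum_n (fun n => Cmod (b n)) N - 1) * exp (- (lam 1%nat * x)).
Proof.
  intros Hlam Hb Hx. induction N as [| N IH].
  - rewrite dirichlet_polynomial_O, sum_O, dirichlet_term_pair, Hb.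
    destruct Hlam as [-> _]. rewrite !Rmult_0_l, Ropp_0, exp_0, cos_0, sin_0.
    rewrite Cmod_1. replace (Cminus _ _) with (RtoC 0).
    + rewrite Cmod_0. lra.
    + apply injective_projections; simpl; ring.
  - rewrite dirichlet_polynomial_S, sum_Sn.
    match goal with |- Cmod (Cminus (Cplus ?p ?t) ?o) <= _ =>
      replace (Cminus (Cplus p t) o) with (Cplus (Cminus p o) t) by ring end.
    eapply Rle_trans; [apply Cmod_triangle |].
    rewrite Cmod_dirichlet_term. unfold plus; simpl.
    assert (He : exp (- (lam (S N) * x)) <= exp (- (lam 1%nat * x))).
    { pose proof (exponents_ge lam N Hlam). apply exp_le. nra. }
    pose proof (Cmod_ge_0 (b (S N))). nra.
Qed.

(** The quantitative heart: at [x = A / lam 1] the polynomial has modulus at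
    least [1/2], while [two_constants] bounds it above in terms of [m].  The
    choice of [x] makes [exp (- lam 1 * x) = 1 / (2 M)]. *)
Lemma dirichlet_polynomial_lower_bound
  (b : nat -> C) (lam : nat -> R) (N : nat) (M m d : R) :
  dirichlet_exponents lam -> b 0%nat = RtoC 1 ->
  sum_n (fun n => Cmod (b n)) N <= M -> 1 <= M ->
  0 < d -> 0 < m <= M ->
  (forall y, Rabs y <= d -> Cmod (dirichlet_polynomial b lam N (0, y)) <= m) ->
  exp (- (PI * ((ln M + ln 2) ^ 2 / (lam 1%nat * (2 * d))
                + 2 * d * lam 1%nat))) <= m.
Proof.
  intros Hlam Hb HM HM1 Hd Hm Hbd.
  set (A := ln M + ln 2). set (l := lam 1%nat).
  assert (Hl : 0 < l) by (unfold l; destruct Hlam as [H0 H]; specialize (H 0%nat); lra).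
  pose proof PI_RGT_0 as Hpi.
  assert (HS : 0 <= ln M).
  { rewrite <- ln_1. apply ln_le; lra. }
  assert (HA : 0 < A) by (unfold A; pose proof ln_lt_2; lra).
  assert (HeA : exp A = 2 * M) by (unfold A; rewrite exp_plus, !exp_ln by lra; ring).
  set (x := A / l).
  assert (Hx : 0 < x) by (apply Rdiv_lt_0_compat; assumption).
  set (P := dirichlet_polynomial b lam N).
  assert (Hhalf : 1 / 2 <= Cmod (P (x, 0))).
  { assert (Hnear := dirichlet_polynomial_near_1 b lam N x Hlam Hb ltac:(lra)).
    fold P l in Hnear.
    replace (l * x) with A in Hnear by (unfold x; field; lra).
    rewrite exp_Ropp, HeA in Hnear.
    assert (Hsmall : Cmod (Cminus (P (x, 0)) (RtoC 1)) <= 1 / 2).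
    { eapply Rle_trans; [exact Hnear |].
      apply Rle_div_l; [lra |]. lra. }
    assert (Htri := Cmod_triangle (P (x, 0)) (Copp (Cminus (P (x, 0)) (RtoC 1)))).
    replace (Cplus (P (x, 0)) (Copp (Cminus (P (x, 0)) (RtoC 1)))) with (RtoC 1) in Htri by ring.
    rewrite Cmod_opp, Cmod_1 in Htri. lra. }
  assert (H2 := two_constants P _ _ M m d
    (dirichlet_polynomial_derivative b lam N)
    (dirichlet_polynomial_derivative (derivative_coefficients b lam) lam N)
    (dirichlet_polynomial_Cmod_continuous b lam N)
    (fun s t Hs => Rle_trans _ _ _
       (dirichlet_polynomial_bound b lam N (s, t) Hlam Hs) HM)
    Hbd Hm Hd x Hx).
  set (K := ln M - ln m) in *.
  (* Were the exponent above [A], the left side of [H2] would exceed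
     [(1/2) exp A = M]. *)
  assert (HK : K * (2 / PI) * atan (d / x) <= A).
  { apply Rnot_lt_le. intros H. apply exp_increasing in H. rewrite HeA in H. nra. }
  assert (HK0 : 0 <= K).
  { unfold K. pose proof (ln_le m M (proj1 Hm) (proj2 Hm)). lra. }
  set (r := d / x) in *.
  assert (Hr : 0 < r) by (apply Rdiv_lt_0_compat; assumption).
  assert (Hat := proj1 (atan_bounds r Hr)).
  assert (HK1 : K <= A * (PI * (1 + r ^ 2) / (2 * r))).
  { apply Rle_trans with (K * (2 / PI) * (r / (1 + r ^ 2)) * (PI * (1 + r ^ 2) / (2 * r))).
    - right. field. repeat split; nra.
    - apply Rmult_le_compat_r.
      + apply Rlt_le, Rdiv_lt_0_compat; nra.
      + eapply Rle_trans; [| exact HK].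
        apply Rmult_le_compat_l; [| exact Hat].
        apply Rmult_le_pos; [exact HK0 |]. apply Rlt_le, Rdiv_lt_0_compat; lra. }
  assert (EK : A * (PI * (1 + r ^ 2) / (2 * r)) = PI * (A ^ 2 / (l * (2 * d)) + d * l / 2)).
  { unfold r, x. field. repeat split; lra. }
  rewrite EK in HK1.
  rewrite <- (exp_ln m) by lra.
  apply exp_le.
  assert (0 < PI * (d * l))
    by (apply Rmult_lt_0_compat; [| apply Rmult_lt_0_compat]; assumption).
  unfold K in HK1. set (Q := A ^ 2 / (l * (2 * d))) in *. lra.
Qed.

(** * Passage to the full series *)

Lemma partial_sum_le_Series (c : nat -> R) (N : nat) :
  (forall n, 0 <= c n) -> ex_series c -> sum_n c N <= Series c.
Proof.
  intros Hc Hex. apply (is_lim_seq_incr_compare (sum_n c)).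
  - apply Series_correct, Hex.
  - intros n. rewrite sum_Sn. unfold plus; simpl. specialize (Hc (S n)). lra.
Qed.

(** On the line the moduli of the terms do not depend on the imaginary part, so
    the Cauchy criterion for the norm controls all blocks of terms at once. *)
Lemma uniform_truncation (a : nat -> C) (lam : nat -> R) (sigma : R) (L : C -> C) (eps : R) :
  abs_convergent_on a lam sigma ->
  (forall s, Re s = sigma -> is_dirichlet_sum a lam s (L s)) ->
  0 < eps ->
  exists N, forall s, Re s = sigma ->
    Cmod (Cminus (L s) (dirichlet_polynomial a lam N s)) <= eps.
Proof.
  intros Habs HL He.
  destruct (Cauchy_ex_series _ Habs (mkposreal eps He)) as [N HN]. simpl in HN.
  exists N. intros s Hs. apply Rnot_lt_le. intros Hgt.
  set (e := Cmod (Cminus (L s) (dirichlet_polynomial a lam N s)) - eps) in *.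
  assert (Hep : 0 < e) by (unfold e; lra).
  assert (Hlim := HL s Hs).
  destruct (proj1 (filterlim_locally_ball_norm _ _) Hlim (mkposreal e Hep)) as [n Hn].
  set (k := max (S N) n).
  specialize (Hn k ltac:(apply Nat.le_max_r)).
  change (Cmod (Cminus (dirichlet_polynomial a lam k s) (L s)) < e) in Hn.
  assert (Hblock : Cmod (Cminus (dirichlet_polynomial a lam k s)
                                (dirichlet_polynomial a lam N s)) < eps).
  { assert (Hk : (S N <= k)%nat) by apply Nat.le_max_l.
    replace (Cminus (dirichlet_polynomial a lam k s) (dirichlet_polynomial a lam N s))
      with (sum_n_m (G := C_NormedModule) (dirichlet_term a lam s) (S N) k)
      by (apply (sum_n_m_sum_n (G := C_NormedModule)); lia).
    eapply Rle_lt_trans;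
      [exact (norm_sum_n_m (K := C_AbsRing) (V := C_NormedModule)
                (dirichlet_term a lam s) (S N) k) |].
    eapply Rle_lt_trans; [| apply (HN (S N) k); lia].
    eapply Rle_trans; [| apply Rle_abs]. right.
    apply sum_n_m_ext. intros i. rewrite <- Hs. apply Cmod_dirichlet_term. }
  assert (Htri := Cmod_triangle (Cminus (L s) (dirichlet_polynomial a lam k s))
    (Cminus (dirichlet_polynomial a lam k s) (dirichlet_polynomial a lam N s))).
  match type of Htri with Cmod ?z <= _ =>
    replace z with (Cminus (L s) (dirichlet_polynomial a lam N s)) in Htri by ring end.
  assert (Hn' : Cmod (Cminus (L s) (dirichlet_polynomial a lam k s)) < e).
  { rewrite <- Cmod_opp. eapply Rle_lt_trans; [right | exact Hn]. f_equal.
    unfold minus, plus, opp, dirichlet_polynomial; simpl. ring. }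
  unfold e in *. lra.
Qed.

Lemma Cmod_dist (z w : C) : Rabs (Cmod z - Cmod w) <= Cmod (Cminus z w).
Proof.
  assert (H1 := Cmod_triangle (Cminus z w) w).
  assert (H2 := Cmod_triangle (Copp (Cminus z w)) z).
  replace (Cplus (Cminus z w) w) with z in H1 by ring.
  replace (Cplus (Copp (Cminus z w)) z) with w in H2 by ring.
  rewrite Cmod_opp in H2. apply Rabs_le. lra.
Qed.

Lemma Cmod_continuous_on_line (f f1 : C -> C) (x y : R) :
  has_complex_derivative f f1 -> continuity_pt (fun t => Cmod (f (x, t))) y.
Proof.
  intros Hf. destruct (Hf x y) as (_ & _ & F3 & F4).
  unfold Cmod.
  apply (continuity_pt_comp (fun t => fst (f (x, t)) ^ 2 + snd (f (x, t)) ^ 2) sqrt).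
  - apply (continuity_pt_plus (fun t => fst (f (x, t)) ^ 2) (fun t => snd (f (x, t)) ^ 2)).
    + apply (continuity_pt_comp (fun t => fst (f (x, t))) (fun r => r ^ 2)).
      * apply ex_derive_continuity_pt. eexists; exact F3.
      * apply ex_derive_continuity_pt. auto_derive; exact I.
    + apply (continuity_pt_comp (fun t => snd (f (x, t))) (fun r => r ^ 2)).
      * apply ex_derive_continuity_pt. eexists; exact F4.
      * apply ex_derive_continuity_pt. auto_derive; exact I.
  - apply continuity_pt_sqrt. pose proof (pow2_ge_0 (fst (f (x, y)))).
    pose proof (pow2_ge_0 (snd (f (x, y)))). lra.
Qed.

Lemma Cmod_dirichlet_sum_continuous (a : nat -> C) (lam : nat -> R) (sigma : R) (L : C -> C) (t : R) :
  abs_convergent_on a lam sigma ->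
  (forall s, Re s = sigma -> is_dirichlet_sum a lam s (L s)) ->
  continuity_pt (fun t => Cmod (L (sigma, t))) t.
Proof.
  intros Habs HL eps He.
  destruct (uniform_truncation a lam sigma L (eps / 3) Habs HL ltac:(lra)) as [N HN].
  destruct (Cmod_continuous_on_line _ _ sigma t (dirichlet_polynomial_derivative a lam N)
              (eps / 3) ltac:(lra)) as [e [He' Hcont]].
  exists e. split; [exact He' |]. intros u Hu. specialize (Hcont u Hu).
  simpl in *. unfold Rdist in *.
  pose proof (Cmod_dist (L (sigma, t)) (dirichlet_polynomial a lam N (sigma, t))) as D1.
  pose proof (Cmod_dist (L (sigma, u)) (dirichlet_polynomial a lam N (sigma, u))) as D2.
  pose proof (HN (sigma, t) eq_refl) as N1.
  pose proof (HN (sigma, u) eq_refl) as N2.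
  apply Rabs_def2 in Hcont. apply Rabs_le_between in D1. apply Rabs_le_between in D2.
  apply Rabs_def1; lra.
Qed.

Theorem theorem17 :
  forall (sigma : R) (a : nat -> C) (lam : nat -> R) (L : C -> C),
    dirichlet_exponents lam ->
    abs_convergent_on a lam sigma ->
    (forall s : C, Re s = sigma -> is_dirichlet_sum a lam s (L s)) ->
    a 0%nat = RtoC 1 ->
    forall delta : R, 0 < delta ->
      (forall T : R, exists m : R, is_maximum (modulus_values L sigma T delta) m) /\
      Rbar_le
        (Finite (exp (- (PI * ((ln (dirichlet_norm1 a lam sigma) + ln 2) ^ 2
                                 / (lam 1%nat * delta)
                               + delta * lam 1%nat)))))
        (Glb_Rbar (fun m => exists T : R,
                     is_maximum (modulus_values L sigma T delta) m)).
Proof.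
  intros sigma a lam L Hlam Habs HL Ha delta Hdelta. split.
  - intros T.
    destruct (continuity_ab_maj (fun t => Cmod (L (sigma, t))) T (T + delta))
      as [t0 [Ht0 Ht0']]; [lra | |].
    + intros t _. now apply (Cmod_dirichlet_sum_continuous a lam).
    + exists (Cmod (L (sigma, t0))). split; [now exists t0 |].
      intros y (t & Ht & ->). now apply Ht0.
  - apply Glb_Rbar_correct. intros mx (T & Hin & Hub). cbn [Rbar_le].
    set (M := dirichlet_norm1 a lam sigma).
    set (s0 := (sigma, T + delta / 2) : C).
    set (b := dirichlet_term a lam s0).
    assert (Eb : forall n, Cmod (b n) = Cmod (a n) * exp (- (lam n * sigma)))
      by (intros n; apply Cmod_dirichlet_term).
    assert (Hb0 : b 0%nat = RtoC 1).
    { unfold b, s0. rewrite dirichlet_term_pair, Ha. destruct Hlam as [-> _].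
      rewrite !Rmult_0_l, Ropp_0, exp_0, cos_0, sin_0.
      apply injective_projections; simpl; ring. }
    assert (HM : forall N, sum_n (fun n => Cmod (b n)) N <= M).
    { intros N. rewrite (sum_n_ext _ _ _ Eb). apply partial_sum_le_Series; [| exact Habs].
      intros n. rewrite <- Eb. apply Cmod_ge_0. }
    assert (HM1 : 1 <= M).
    { specialize (HM 0%nat). rewrite sum_O, Hb0, Cmod_1 in HM. exact HM. }
    apply Rnot_lt_le. intros Hlt.
    set (E := exp _) in Hlt.
    assert (HE1 : E <= 1).
    { unfold E. apply Rle_trans with (exp 0); [| right; apply exp_0].
      assert (Hl : 0 < lam 1%nat) by (destruct Hlam as [H0 H]; specialize (H 0%nat); lra).
      pose proof PI_RGT_0 as Hpi.
      assert (HQ : 0 <= (ln M + ln 2) ^ 2 / (lam 1%nat * delta))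
        by (apply Rdiv_le_0_compat; [apply pow2_ge_0 | now apply Rmult_lt_0_compat]).
      apply exp_le, Rge_le, Ropp_0_le_ge_contravar, Rmult_le_pos; [lra |].
      apply Rplus_le_le_0_compat; [exact HQ |].
      now apply Rlt_le, Rmult_lt_0_compat. }
    assert (Hmx0 : 0 <= mx) by (destruct Hin as (t & _ & ->); apply Cmod_ge_0).
    (* If the maximum [mx] were below the bound [E], a partial sum within
       [(E - mx) / 2] of [L] would stay below [m < E] on the window. *)
    set (m := (mx + E) / 2).
    destruct (uniform_truncation a lam sigma L ((E - mx) / 2) Habs HL ltac:(lra)) as [N HN].
    assert (Hcontra : E <= m); [| unfold m in Hcontra; lra].
    unfold E. replace delta with (2 * (delta / 2)) by field.
    apply (dirichlet_polynomial_lower_bound b lam N M m (delta / 2) Hlam Hb0 (HM N) HM1).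
    + lra.
    + unfold m; lra.
    + intros y Hy. apply Rabs_le_between in Hy.
      assert (Et : dirichlet_polynomial b lam N (0, y)
                   = dirichlet_polynomial a lam N (sigma, T + delta / 2 + y)).
      { apply sum_n_ext. intros n. unfold b. rewrite dirichlet_term_translate.
        f_equal. unfold s0, Cplus; simpl. now rewrite Rplus_0_r. }
      rewrite Et.
      assert (HLm : Cmod (L (sigma, T + delta / 2 + y)) <= mx).
      { apply Hub. exists (T + delta / 2 + y). split; [lra | reflexivity]. }
      pose proof (HN (sigma, T + delta / 2 + y) eq_refl) as HNy.
      pose proof (Cmod_dist (L (sigma, T + delta / 2 + y))
        (dirichlet_polynomial a lam N (sigma, T + delta / 2 + y))) as Hdist.
      apply Rabs_le_between in Hdist. unfold m. lra.
Qed.
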